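(* Let $R,J:\mathbb{R}^n\to]-\infty,+\infty]$ be proper, convex and lower semi-continuous with $\mathrm{ri}(\mathrm{dom}(R))\cap\mathrm{ri}(\mathrm{dom}(J))\neq\emptyset$ and $\mathrm{Argmin}(R+J)\neq\emptyset$. Let $\gamma>0$, $z_0\in\mathbb{R}^n$, $x_0=\mathrm{prox}_{\gamma J}(z_0)$, and let $\{u_k\},\{z_k\},\{x_k\}$ be generated by the Douglas--Rachford iteration $$u_{k+1}=\mathrm{prox}_{\gamma R}(2x_k-z_k),\qquad z_{k+1}=z_k+u_{k+1}-x_k,\qquad x_{k+1}=\mathrm{prox}_{\gamma J}(z_{k+1}),$$ so that $z_k\to z^\star$ (a fixed point of the iteration) and $x_k,u_k\to x^\star=\mathrm{prox}_{\gamma J}(z^\star)\in\mathrm{Argmin}(R+J)$. Assume that $R$ and $J$ are partly smooth at $x^\star$ relative to $C^2$-manifolds $\mathcal{M}^R_{x^\star}$ and $\mathcal{M}^J_{x^\star}$ respectively, with tangent spaces $T^R_{x^\star}$, $T^J_{x^\star}$ at $x^\star$, and that $$x^\star-z^\star\in\gamma\,\mathrm{ri}(\partial R(x^\star))\quad\text{and}\quad z^\star-x^\star\in\gamma\,\mathrm{ri}(\partial J(x^\star)).$$ If, moreover, $R$ and $J$ are locally polyhedral around $x^\star$, then for all $k$ large enough $z_{k+1}-z_k=M_{\mathrm{DR}}(z_k-z_{k-1})$ with $$M_{\mathrm{DR}}=P_{T^R_{x^\star}}P_{T^J_{x^\star}}+(\mathrm{Id}-P_{T^R_{x^\star}})(\mathrm{Id}-P_{T^J_{x^\star}}).$$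 If moreover $\dim(T^R_{x^\star}\cap T^J_{x^\star})<\min\{\dim(T^R_{x^\star}),\dim(T^J_{x^\star})\}$, then the angle $\theta_k$ between $v_k=z_k-z_{k-1}$ and $v_{k-1}$ converges to $\theta_F\in]0,\pi/2]$, where $\theta_F$ is the Friedrichs angle between $T^R_{x^\star}$ and $T^J_{x^\star}$, and $\{z_k\}$ is a Type II sequence.
   Context: $\mathrm{prox}_{\gamma R}(w)=\mathrm{argmin}_{x}\ \gamma R(x)+\frac12\|x-w\|^2$; $\partial R$ is the convex subdifferential; $\mathrm{ri}$ is the relative interior; $P_T$ is the orthogonal projection onto a subspace $T$; $\mathrm{par}(C)$ is the linear subspace parallel to the affine hull of a convex set $C$. A proper convex lower semi-continuous function $R$ on $\mathbb{R}^n$ is partly smooth at $\bar x$ relative to a set $\mathcal{M}_{\bar x}$ if $\mathcal{M}_{\bar x}$ is a $C^2$ manifold (embedded submanifold of $\mathbb{R}^n$) around $\bar x$ and: (Smoothness) $R$ restricted to $\mathcal{M}_{\bar x}$ is $C^2$ around $\bar x$; (Sharpness) the tangent space of $\mathcal{M}_{\bar x}$ at $\bar x$ equals $\mathrm{par}(\partial R(\bar x))^\perp$; (Continuity) the set-valued map $\partial R$ is continuous at $\bar x$ relative to $\mathcal{M}_{\bar x}$. A function is polyhedral if its epigraph is a polyhedral set; it is locally polyhedral around a point if it coincides with a polyhedral function on a neighbourhood of that point. The Friedrichs angle $\theta_F\in]0,\pi/2]$ between subspaces $T_1,T_2$ is defined by $\cos(\theta_F)=\max\langle u,v\rangle$ subject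 to $u\in T_1\cap(T_1\cap T_2)^\perp$, $\|u\|=1$, $v\in T_2\cap(T_1\cap T_2)^\perp$, $\|v\|=1$. The angle is $\theta_k=\arccos\big(\frac{\langle v_k,v_{k-1}\rangle}{\|v_k\|\|v_{k-1}\|}\big)$. A sequence is called Type II (logarithmic spiral trajectory) if $\theta_k$ converges to some nonzero angle $\theta_F\in]0,\pi/2[$.
   Formalization: The convergence of θ_k to θ_F and the Type II claim are proved under the added condition that, for infinitely many k, v_k is not orthogonal to all vectors u, v attaining the Friedrichs angle; without it they fail (e.g. z_0 = z*, θ_F = π/2, or z_0 exciting only a larger principal angle). *)

(* Defs.v *)
From HB Require Import structures.
From mathcomp Require Import all_boot all_order all_algebra.
From mathcomp Require Import all_classical all_reals all_analysis.
Set Implicit Arguments.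
Unset Strict Implicit.
Unset Printing Implicit Defensive.
Import Order.TTheory GRing.Theory Num.Theory.
Import numFieldNormedType.Exports.
Local Open Scope classical_set_scope.
Local Open Scope ring_scope.

(* MathComp-Analysis. R^n is 'rV[K]_n with K : realType. The library norm on
   'rV[K]_n is the sup norm: it is used only for the topology and for
   derivatives. Metric notions use the Euclidean [dot] and [enorm]. *)

Section Euclidean.
Context {K : realType} {n : nat}.
Local Notation V := 'rV[K]_n.

Definition dot (u v : V) : K := \sum_(i < n) u 0 i * v 0 i.

Definition enorm (u : V) : K := Num.sqrt (dot u u).

Definition orth (S : set V) : set V :=
  [set v | forall w, S w -> dot v w = 0].

(* [projv] of the vector library projects along an arbitrary complement, so the
   orthogonal projection is defined here; the specified point exists and is
   unique. *)
Definition oproj (T : {vspace V}) (x : V) : V :=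
  xget 0 [set p | p \in T /\ orth [set` T] (x - p)].

Definition angle (u v : V) : K := acos (dot u v / (enorm u * enorm v)).

End Euclidean.

Section ConvexAnalysis.
Context {K : realType} {n : nat}.
Local Notation V := 'rV[K]_n.
Implicit Types (f : V -> \bar K) (C : set V).

Definition proper f : Prop :=
  (forall x, -oo < f x)%E /\ (exists x, f x < +oo)%E.

Definition convex_fun f : Prop := forall (x y : V) (t : K), 0 < t < 1 ->
  (f (t *: x + (1 - t) *: y)%R <= t%:E * f x + (1 - t)%:E * f y)%E.

Definition proper_convex_lsc f : Prop :=
  [/\ proper f, convex_fun f & lower_semicontinuous f].

Definition dom f : set V := [set x | (f x < +oo)%E].

Definition argmin f : set V := [set x | forall y, (f x <= f y)%E].

(* For f proper convex lsc and g > 0 this set is a singleton: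
   [prox g f w x] reads x = prox_{g f}(w). *)
Definition prox (g : K) f (w : V) : set V :=
  argmin (fun x => g%:E * f x + (2^-1 * enorm (x - w) ^+ 2)%:E)%E.

(* If f is proper, this set is empty whenever f x = +oo. *)
Definition subdiff f (x : V) : set V :=
  [set g | forall y, (f x + (dot g (y - x))%:E <= f y)%E].

Definition aff C : set V :=
  [set y | exists (m : nat) (c : 'I_m -> K) (p : 'I_m -> V),
     [/\ forall i, C (p i), \sum_i c i = 1 & y = \sum_i c i *: p i]].

Definition par C : set V :=
  [set v | exists a b, [/\ aff C a, aff C b & v = a - b]].

Definition ri C : set V :=
  [set x | C x /\ \forall y \near x, aff C y -> C y].

Definition polyhedral_set (S : set (V * K)) : Prop :=
  exists (m : nat) (a : 'I_m -> V) (b c : 'I_m -> K),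
    S = [set p | forall i, dot (a i) p.1 + b i * p.2 <= c i].

Definition epigraph f : set (V * K) := [set p | (f p.1 <= p.2%:E)%E].

Definition polyhedral f : Prop := polyhedral_set (epigraph f).

Definition locally_polyhedral f (x : V) : Prop :=
  exists2 g, polyhedral g & \forall y \near x, f y = g y.

End ConvexAnalysis.

Section PartialSmoothness.
Context {K : realType} {n : nat}.
Local Notation V := 'rV[K]_n.
Implicit Types (f : V -> \bar K) (M : set V) (x : V).

(* Meant for U open. *)
Fixpoint Ck (k : nat) (U : set V) (h : V -> K) {struct k} : Prop :=
  (forall x, U x -> {for x, continuous h}) /\
  match k with
  | 0%N => True
  | k'.+1 => forall i : 'I_n,
      (forall x, U x -> derivable h x (delta_mx 0 i)) /\
      Ck k' U (fun x => 'D_(delta_mx 0 i) h x)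
  end.

(* Embedded submanifold given by local equations F_1 = ... = F_m = 0 with
   linearly independent gradients at x, hence near x; m = 0 is the open case. *)
Definition C2_manifold_around M x : Prop :=
  M x /\ exists (U : set V) (m : nat) (F : 'I_m -> V -> K),
    [/\ open U, U x, forall i, Ck 2 U (F i),
        forall y, U y -> (M y <-> forall i, F i y = 0) &
        row_free (\matrix_(i < m, j < n) 'D_(delta_mx 0 j) (F i) x)].

(* Velocities at x of the C^1 curves drawn on M. *)
Definition tangent_space M x : set V :=
  [set v | exists c : K -> V,
     [/\ c 0 = x,
         \forall t \near (0 : K), M (c t),
         \forall t \near (0 : K), derivable c t 1 /\ {for t, continuous (derive1 c)} &
         derive1 c 0 = v]].

Definition C2_along f M x : Prop :=
  exists (U : set V) (h : V -> K),
    [/\ open U, U x, Ck 2 U h & forall y, U y -> M y -> f y = (h y)%:E].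

Definition outer_limit (S : V -> set V) M x : set V :=
  [set g | exists y h : nat -> V,
     [/\ forall k, M (y k), y @ \oo --> x, forall k, S (y k) (h k) &
         h @ \oo --> g]].

Definition inner_limit (S : V -> set V) M x : set V :=
  [set g | forall y : nat -> V, (forall k, M (y k)) -> y @ \oo --> x ->
     exists2 h : nat -> V, \forall k \near \oo, S (y k) (h k) & h @ \oo --> g].

(* Painleve-Kuratowski continuity of a set-valued map *)
Definition setvalued_continuous_at (S : V -> set V) M x : Prop :=
  outer_limit S M x `<=` S x /\ S x `<=` inner_limit S M x.

Definition partly_smooth f M x : Prop :=
  [/\ C2_manifold_around M x,
      C2_along f M x,
      tangent_space M x = orth (par (subdiff f x)) &
      setvalued_continuous_at (subdiff f) M x].

End PartialSmoothness.

Section Trajectory.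
Context {K : realType} {n : nat}.
Local Notation V := 'rV[K]_n.
Implicit Types (z : nat -> V).

Definition friedrichs_feasible (T1 T2 : {vspace V}) (u v : V) : Prop :=
  [/\ u \in T1, orth [set` (T1 :&: T2)%VS] u, enorm u = 1 &
   [/\ v \in T2, orth [set` (T1 :&: T2)%VS] v & enorm v = 1]].

Definition friedrichs_pair (T1 T2 : {vspace V}) (u v : V) : Prop :=
  friedrichs_feasible T1 T2 u v /\
  forall u' v', friedrichs_feasible T1 T2 u' v' -> dot u' v' <= dot u v.

Definition friedrichs_angle (T1 T2 : {vspace V}) (t : K) : Prop :=
  0 < t <= pi / 2 /\ exists u v, friedrichs_pair T1 T2 u v /\ cos t = dot u v.

Definition MDR (T1 T2 : {vspace V}) (w : V) : V :=
  oproj T1 (oproj T2 w) +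
  ((w - oproj T2 w) - oproj T1 (w - oproj T2 w)).

(* v_k and theta_k; only the values for k >= 1, resp. k >= 2, are meaningful *)
Definition vel z (k : nat) : V := z k - z k.-1.

Definition theta z (k : nat) : K := angle (vel z k) (vel z k.-1).

Definition type_II z : Prop :=
  exists2 t : K, 0 < t < pi / 2 & theta z @ \oo --> t.

(* The v_k do not become, for all large k, orthogonal to every vector at which
   the Friedrichs angle is attained; in particular they do not eventually
   vanish, in which case theta_k would be undefined. The convergence of theta_k
   to the Friedrichs angle fails without this: take R and J indicators of two
   planes of R^4 with principal angles 0 < a < b < pi/2, and z_0 in the span of
   the pair of principal vectors of angle b. Then no v_k vanishes, and theta_k
   is b for all k. If the Friedrichs angle is pi/2, v_k eventually vanishes, so
   this condition excludes that case, as type_II itself does. *)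
Definition friedrichs_excited (T1 T2 : {vspace V}) z : Prop :=
  forall N : nat, exists2 k, (N <= k)%N &
    exists u v, friedrichs_pair T1 T2 u v /\
      (dot (vel z k) u != 0 \/ dot (vel z k) v != 0).

End Trajectory.

(* Main.v *)
Require Import Defs.
From HB Require Import structures.
From mathcomp Require Import all_boot all_order all_algebra.
From mathcomp Require Import all_classical all_reals all_analysis.
From mathcomp Require Import ring lra.
Import Order.TTheory GRing.Theory Num.Theory.
Import numFieldNormedType.Exports.
Local Open Scope classical_set_scope.
Local Open Scope ring_scope.

(* Let C be a subdifferential at xs and T the orthogonal complement of par C.
   Each active constraint a.y + b.r <= c of the local polyhedron yields a
   subgradient g + (a + b g)/(1 - b), so d in T saturates it: the function is
   affine on xs + T near xs, and C stays contained in the subdifferential along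
   xs + T. With the relative interior condition, prox is therefore
   w |-> xs + P_T (w - ws) near ws, and z_{k+1} - zs = MDR (z_k - zs).

   For M = MDR one has M + M^* = 2 M^* M = 2 M M^*, so that
   cos theta_{k+1} = |v_{k+1}| / |v_k|, and this ratio is nondecreasing. Let c be
   the cosine of the Friedrichs angle. As v_k -> 0, the v_k have no component
   fixed by M, whence |v_{k+1}| <= c |v_k|. On the plane spanned by a Friedrichs
   pair M acts as c times a rotation, so the excited component of v_k decays
   exactly like c^k, which forces the ratio to tend to c. *)

(** * The Euclidean inner product on row vectors *)

Section InnerProduct.
Context {K : realType} {n : nat}.
Local Notation V := 'rV[K]_n.
Implicit Types (u v w : V) (a : K).

Lemma dotC u v : dot u v = dot v u.
Proof. by apply: eq_bigr => i _; rewrite mulrC. Qed.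

Lemma dotDl u v w : dot (u + v) w = dot u w + dot v w.
Proof. by rewrite -big_split; apply: eq_bigr => i _; rewrite mxE mulrDl. Qed.

Lemma dotZl a u v : dot (a *: u) v = a * dot u v.
Proof. by rewrite mulr_sumr; apply: eq_bigr => i _; rewrite mxE mulrA. Qed.

Lemma dotDr u v w : dot w (u + v) = dot w u + dot w v.
Proof. by rewrite dotC dotDl !(dotC w). Qed.

Lemma dotZr a u v : dot u (a *: v) = a * dot u v.
Proof. by rewrite dotC dotZl dotC. Qed.

Lemma dotNl u v : dot (- u) v = - dot u v.
Proof. by rewrite -scaleN1r dotZl mulN1r. Qed.

Lemma dotNr u v : dot u (- v) = - dot u v.
Proof. by rewrite dotC dotNl dotC. Qed.

Lemma dotBl u v w : dot (u - v) w = dot u w - dot v w.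
Proof. by rewrite dotDl dotNl. Qed.

Lemma dotBr u v w : dot w (u - v) = dot w u - dot w v.
Proof. by rewrite dotDr dotNr. Qed.

Lemma dot0l u : dot 0 u = 0.
Proof. by rewrite -(scale0r 0) dotZl mul0r. Qed.

Lemma dot0r u : dot u 0 = 0.
Proof. by rewrite dotC dot0l. Qed.

Lemma dot_sumr m (f : 'I_m -> V) u :
  dot u (\sum_i f i) = \sum_i dot u (f i).
Proof. by elim/big_rec2: _ => [|i x y _ <-]; rewrite ?dot0r ?dotDr. Qed.

Lemma dot_ge0 u : 0 <= dot u u.
Proof. by apply: sumr_ge0 => i _; rewrite -expr2 sqr_ge0. Qed.

Lemma dot_eq0 u : (dot u u == 0) = (u == 0).
Proof.
apply/eqP/eqP => [|->]; last exact: dot0l.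
move=> /eqP; rewrite psumr_eq0; last by move=> i _; rewrite -expr2 sqr_ge0.
move=> /allP u0; apply/rowP => i; rewrite mxE; apply/eqP.
by have := u0 i (mem_index_enum i); rewrite mulf_eq0 orbb.
Qed.

Lemma dot_gt0 u : (0 < dot u u) = (u != 0).
Proof. by rewrite lt_def dot_ge0 andbT dot_eq0. Qed.

Lemma enorm_ge0 u : 0 <= enorm u.
Proof. exact: sqrtr_ge0. Qed.

Lemma sqr_enorm u : enorm u ^+ 2 = dot u u.
Proof. by rewrite sqr_sqrtr ?dot_ge0. Qed.

Lemma enorm_eq1 u : (enorm u = 1) <-> (dot u u = 1).
Proof.
rewrite -sqr_enorm; split=> [->|/eqP]; first by rewrite expr1n.
by rewrite pexpr_eq1 ?enorm_ge0// => /eqP.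
Qed.

Lemma enorm_gt0 u : (0 < enorm u) = (u != 0).
Proof. by rewrite sqrtr_gt0 dot_gt0. Qed.

Lemma cauchy_schwarz u v : dot u v ^+ 2 <= dot u u * dot v v.
Proof.
have [->|v0] := eqVneq v 0; first by rewrite !dot0r expr0n mulr0.
have vv : 0 < dot v v by rewrite dot_gt0.
rewrite -subr_ge0 -(pmulr_rge0 _ vv).
have := dot_ge0 (dot v v *: u - dot u v *: v).
rewrite !(dotBl, dotBr, dotZl, dotZr) (dotC v u); congr (0 <= _); ring.
Qed.

Lemma cvg_sumr {T : Type} (F : set_system T) {FF : Filter F} {W : normedModType K}
  m (f : 'I_m -> T -> W) (l : 'I_m -> W) :
  (forall i, f i x @[x --> F] --> l i) ->
  \sum_i f i x @[x --> F] --> \sum_i l i.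
Proof. by move=> fl; apply: cvg_big => //; exact: add_continuous. Qed.

Lemma cvg_coord {T : Type} (F : set_system T) {FF : Filter F} (f : T -> V) (l : V) i :
  f x @[x --> F] --> l -> f x 0 i @[x --> F] --> l 0 i.
Proof. by move=> fl; exact: (cvg_comp _ _ fl (@coord_continuous _ _ _ 0 i l)). Qed.

Lemma cvg_dot {T : Type} (F : set_system T) {FF : Filter F} (f g : T -> V) (k l : V) :
  f x @[x --> F] --> k -> g x @[x --> F] --> l ->
  dot (f x) (g x) @[x --> F] --> dot k l.
Proof. by move=> fk gl; apply: cvg_sumr => i; apply: cvgM; exact: cvg_coord. Qed.

End InnerProduct.

(** * Orthogonal projection onto a subspace *)

Section OrthogonalProjection.
Context {K : realType} {n : nat}.
Local Notation V := 'rV[K]_n.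
Implicit Types (u v w x y : V) (S T U : {vspace V}).

Lemma orthS (A B : set V) : A `<=` B -> orth B `<=` orth A.
Proof. by move=> AB v Bv w /AB /Bv. Qed.

(** Gram-Schmidt: [v] is replaced by its component [v'] orthogonal to the span of [X], and the
    projection of [x] along [v'] is added. *)
Lemma span_oproj_exists (X : seq V) x :
  exists2 p, p \in <<X>>%VS & orth [set` <<X>>%VS] (x - p).
Proof.
elim: X x => [|v X IH] x.
  exists 0; first exact: mem0v.
  by move=> w; rewrite /= span_nil memv0 => /eqP ->; rewrite dot0r.
have [q qX qo] := IH v; have [p pX po] := IH x.
pose v' := v - q.
have X_le : {subset <<X>>%VS <= <<v :: X>>%VS}.
  by move=> y yX; rewrite span_cons memvE (subv_trans _ (addvSr _ _)).
have v_in : v \in <<v :: X>>%VS by rewrite memv_span// mem_head.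
pose c := dot x v' / dot v' v'.
exists (p + c *: v').
  by apply: memvD; [exact: X_le | apply/memvZ/memvB => //; exact: X_le].
move=> w; rewrite /= span_cons => /memv_addP[_ /vlineP[k ->] [r rX ->]].
have -> : k *: v + r = k *: v' + (k *: q + r).
  by rewrite addrA -scalerDr subrK.
have sX : k *: q + r \in <<X>>%VS by rewrite memvD// memvZ.
move: (k *: q + r) sX => s sX.
have v's : dot v' s = 0 by exact: qo.
have xps : dot (x - p) s = 0 by exact: po.
have pv' : dot p v' = 0 by rewrite dotC; exact: qo.
rewrite opprD addrA dotDr [X in X + _]dotBl [X in _ + X]dotBl.
rewrite !dotZr !dotZl v's xps mulr0 subr0 addr0 dotBl pv' subr0 /c.
have [->|v'0] := eqVneq v' 0; first by rewrite !dot0r !mulr0 subr0.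
by rewrite divfK ?subrr ?mulr0// dot_eq0.
Qed.

Lemma oproj_spec T x : oproj T x \in T /\ orth [set` T] (x - oproj T x).
Proof.
rewrite /oproj; case: xgetP => [p -> //|no].
have [p pT po] := span_oproj_exists (vbasis T) x.
by case: (no p); rewrite (span_basis (vbasisP T)) in pT po; split.
Qed.

Lemma oproj_in T x : oproj T x \in T.
Proof. by case: (oproj_spec T x). Qed.

Lemma oproj_orth T x : orth [set` T] (x - oproj T x).
Proof. by case: (oproj_spec T x). Qed.

Lemma oproj_unique T x p : p \in T -> orth [set` T] (x - p) -> oproj T x = p.
Proof.
move=> pT po; apply/eqP; rewrite -subr_eq0 -dot_eq0.
have dT : oproj T x - p \in T by rewrite memvB ?oproj_in.
have := po _ dT; have := oproj_orth T x _ dT.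
rewrite (_ : oproj T x - p = (x - p) - (x - oproj T x)); last first.
  by rewrite opprB [RHS]addrC addrA subrK.
by move=> e1 e2; rewrite [X in X == _]dotBl e1 e2 subrr.
Qed.

Lemma oprojD T x y : oproj T (x + y) = oproj T x + oproj T y.
Proof.
apply: oproj_unique; first by rewrite memvD ?oproj_in.
move=> w wT; rewrite opprD addrACA dotDl.
by rewrite !oproj_orth// addr0.
Qed.

Lemma oprojZ T (a : K) x : oproj T (a *: x) = a *: oproj T x.
Proof.
apply: oproj_unique; first by rewrite memvZ ?oproj_in.
by move=> w wT; rewrite -scalerBr dotZl oproj_orth// mulr0.
Qed.

Lemma oprojB T x y : oproj T (x - y) = oproj T x - oproj T y.
Proof. by rewrite -scaleN1r oprojD oprojZ scaleN1r. Qed.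

Lemma oproj_id T x : x \in T -> oproj T x = x.
Proof.
by move=> xT; apply: oproj_unique => // w _; rewrite subrr dot0l.
Qed.

Lemma oproj_orth0 T x : orth [set` T] x -> oproj T x = 0.
Proof. by move=> xT; apply: oproj_unique; rewrite ?mem0v ?subr0. Qed.

Lemma dot_oprojl T x y : dot (oproj T x) y = dot (oproj T x) (oproj T y).
Proof.
apply/eqP; rewrite -subr_eq0 -dotBr dotC oproj_orth//; exact: oproj_in.
Qed.

Lemma dot_oproj T x y : dot (oproj T x) y = dot x (oproj T y).
Proof. by rewrite dot_oprojl dotC -dot_oprojl dotC. Qed.

(** The residual [x - oproj T x] is orthogonal to [T], hence to [x] by hypothesis and to
    [oproj T x]; it is thus orthogonal to itself. *)
Lemma orth_oproj_in T x : orth (orth [set` T]) x -> x \in T.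
Proof.
move=> xTT; suff /eqP : x - oproj T x = 0.
  by rewrite subr_eq0 => /eqP ->; exact: oproj_in.
apply/eqP; rewrite -dot_eq0 [X in X == _]dotBl.
rewrite xTT; last exact: oproj_orth.
by rewrite dotC oproj_orth ?subrr//; exact: oproj_in.
Qed.

(** By linearity [oproj T y] is a finite sum of fixed vectors weighted by the coordinates of [y],
    and coordinates are continuous. *)
Lemma cvg_oproj T {I : Type} (F : set_system I) {FF : Filter F} (f : I -> V) (l : V) :
  f x @[x --> F] --> l -> oproj T (f x) @[x --> F] --> oproj T l.
Proof.
move=> fl.
have oprojE y : oproj T y = \sum_i y 0 i *: oproj T (delta_mx 0 i).
  rewrite {1}[y]row_sum_delta.
  by elim/big_rec2: _ => [|i a b _ <-];
    rewrite ?oprojD ?oprojZ// oproj_orth0// => w _; rewrite dot0l.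
rewrite oprojE; under eq_cvg do rewrite oprojE.
apply: cvg_sumr => i; apply: cvgZr_tmp; exact: cvg_coord.
Qed.

End OrthogonalProjection.

(** * Affine hulls and their directions *)

Section AffineHull.
Context {K : realType} {n : nat}.
Local Notation V := 'rV[K]_n.
Implicit Types (C : set V) (g h w d : V) (T : {vspace V}).

Lemma sub_aff C : C `<=` aff C.
Proof.
move=> p Cp; exists 1%N, (fun=> 1), (fun=> p).
by split=> //; rewrite big_ord1 ?scale1r.
Qed.

Lemma par_sub C g h : C g -> C h -> par C (g - h).
Proof. by move=> Cg Ch; exists g, h; split=> //; exact: sub_aff. Qed.

Lemma aff_dot C g w a : C g -> (forall c, C c -> dot w (c - g) = 0) ->
  aff C a -> dot w a = dot w g.
Proof.
move=> Cg wC [m [c [p [Cp c1 ->]]]].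
rewrite dot_sumr -[RHS]mul1r -c1 mulr_suml; apply: eq_bigr => i _.
by rewrite dotZr; congr (_ * _); apply/eqP; rewrite -subr_eq0 -dotBr wC.
Qed.

Lemma spanning_differences C g : exists X : seq V,
  (forall v, v \in X -> C (g + v)) /\ (forall c, C c -> c - g \in <<X>>%VS).
Proof.
(* [k] bounds the number of extensions left: adding a difference outside the span raises its
   dimension, which cannot exceed [n]. *)
suff H k (X : seq V) : (n < \dim <<X>> + k)%N ->
    (forall v, v \in X -> C (g + v)) -> exists X : seq V,
    (forall v, v \in X -> C (g + v)) /\ (forall c, C c -> c - g \in <<X>>%VS).
  by apply: (H n.+1 [::]) => //; rewrite addnS ltnS leq_addl.
elim: k X => [|k IH] X Xk XC.
  have := dimvS (subvf <<X>>%VS).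
  by rewrite dimvf dim_matrix mul1r leqNgt -[X in (X < _)%N]/n -(addn0 (\dim _)) Xk.
have [[c [Cc cX]]|no] := pselect (exists c, C c /\ c - g \notin <<X>>%VS); last first.
  by exists X; split=> // c Cc; apply/negPn/negP => cX; apply: no; exists c.
apply: (IH (c - g :: X)); last first.
  by move=> v; rewrite inE => /orP[/eqP ->|/XC//]; rewrite addrC subrK.
apply: leq_trans Xk _; rewrite addnS -addSn leq_add2r.
have XcX : (<<X>> <= <<c - g :: X>>)%VS by rewrite span_cons addvSr.
rewrite ltn_neqAle dimvS// andbT (dimv_leqif_sup XcX); apply/negP => /subvP h.
by case/negP: cX; apply: h; rewrite memv_span// mem_head.
Qed.

Lemma aff_add_span C g d (X : seq V) : C g -> (forall v, v \in X -> C (g + v)) ->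
  d \in <<X>>%VS -> aff C (g + d).
Proof.
move=> Cg XC dX.
pose k i := coord (in_tuple X) i d; pose s := \sum_j k j.
(* The points [g + v], for [v] in [X], get the coordinates of [d] as weights; [g], at index [0],
   gets the rest [1 - s]. *)
exists (size X).+1,
  (fun i => if unlift ord0 i is Some j then k j else 1 - s),
  (fun i => if unlift ord0 i is Some j then g + X`_j else g).
split=> [i||].
- by case: unliftP => [j _|_] //; apply/XC/mem_nth.
- rewrite big_ord_recl unlift_none.
  under eq_bigr do rewrite /= liftK.
  exact: subrK.
- rewrite big_ord_recl unlift_none.
  under eq_bigr do rewrite /= liftK scalerDr.
  rewrite big_split/= -scaler_suml -/s addrA -scalerDl subrK scale1r.
  by rewrite {1}(coord_span (X := in_tuple X) dX).
Qed.

(** A vector orthogonal to all differences of points of [C] is orthogonal to [par C], so it lies in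
    [T] and is orthogonal to [d]. Hence [d] is in the double orthogonal of the span of these
    differences, which is that span. *)
Lemma aff_add_orth C g T d : C g -> [set` T] = orth (par C) ->
  orth [set` T] d -> aff C (g + d).
Proof.
move=> Cg TE dT; have [X [XC CX]] := spanning_differences C g.
apply: (aff_add_span _ _ _ _ Cg XC); apply: orth_oproj_in.
apply: orthS dT; rewrite TE => w wX _ [a [b [Ca Cb ->]]].
have wC c : C c -> dot w (c - g) = 0 by move=> Cc; exact/wX/CX.
by rewrite dotBr (aff_dot _ _ _ _ Cg wC Ca) (aff_dot _ _ _ _ Cg wC Cb) subrr.
Qed.

End AffineHull.

(** * Subdifferentials and proximal maps of locally polyhedral functions *)

Section ProximalMap.
Context {K : realType} {n : nat}.
Local Notation V := 'rV[K]_n.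
Implicit Types (f : V -> \bar K) (g h w x y d : V) (T : {vspace V}).

Lemma subdiff_fin_num f x g : Defs.proper f -> subdiff f x g -> f x \is a fin_num.
Proof.
move=> [fNy [y fy]] /(_ y) fx; rewrite fin_numElt fNy/=.
move: fx; case: (f x) => [r _|/= fx|_]; rewrite ?ltry ?ltNyr//.
by move: (le_lt_trans fx fy); rewrite ltxx.
Qed.

(** At a point of the segment from [x] to [y] close to [x], convexity turns the local inequality
    into [t] times the global one, and [t > 0] cancels. *)
Lemma subdiff_local f x h : Defs.proper f -> convex_fun f -> f x \is a fin_num ->
  (\forall y \near x, (f x + (dot h (y - x))%:E <= f y)%E) -> subdiff f x h.
Proof.
move=> [fNy _] cf; case fx: (f x) => [r| |] // _ loc y.
have := fNy y; case fy: (f y) => [s| |] // _; last by rewrite leey.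
have seg : t *: y + (1 - t) *: x @[t --> (0 : K)^'+] --> x.
  have t0 : t @[t --> (0 : K)^'+] --> (0 : K) by apply: cvg_at_right_filter; exact: cvg_id.
  have : t *: y + (1 - t) *: x @[t --> (0 : K)^'+] --> 0 *: y + (1 - 0) *: x.
    by apply: cvgD; apply: cvgZr_tmp => //; apply: cvgB => //; exact: cvg_cst.
  by rewrite scale0r subr0 scale1r add0r.
have [t [t0 [t1 tloc]]] : exists t : K, 0 < t /\ t < 1 /\
    (r%:E + (dot h (t *: y + (1 - t) *: x - x))%:E <= f (t *: y + (1 - t) *: x)%R)%E.
  near (0 : K)^'+ => t; exists t; split; first by near: t; exact: nbhs_right_gt.
  split; first by near: t; exact: nbhs_right_lt.
  by near: t; exact: (seg _ loc).
have t01 : 0 < t < 1 by rewrite t0 t1.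
have := le_trans tloc (cf y x t t01).
rewrite fx fy -!EFinM -!EFinD !lee_fin.
have -> : t *: y + (1 - t) *: x - x = t *: (y - x).
  by rewrite scalerBl scale1r scalerBr -!addrA; congr (_ + _); rewrite addrCA addrN addr0.
rewrite dotZr => H; rewrite -subr_ge0 -(pmulr_rge0 _ t0).
by move: H; rewrite -subr_ge0; congr (0 <= _); ring.
Unshelve. all: by end_near. Qed.

Lemma active_constraint_orth f x g w (a : V) (b c r : K) :
  Defs.proper f -> convex_fun f -> f x = r%:E -> subdiff f x g ->
  (\forall y \near x, forall s : K, (f y <= s%:E)%E -> dot a y + b * s <= c) ->
  dot a x + b * r = c ->
  orth (par (subdiff f x)) w -> dot a w + b * dot g w = 0.
Proof.
move=> pf cf fx gx epi act wT.
(* Epigraphs are closed upwards: raising the saturated point [(x, r)] by [1] cannot violate the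
   constraint. *)
have b_le0 : b <= 0.
  have := nbhs_singleton epi (r + 1); rewrite fx lee_fin lerDl ler01 => /(_ isT).
  by rewrite mulrDr mulr1 addrA act gerDl.
have b1 : 0 < 1 - b by lra.
(* Since [1 + k * b = k], the inequality for [g + k *: (a + b *: g)] is [k] times the sum of the one
   for [g] and of the constraint. Dividing by [1 - b] rather than by [- b] also covers vertical
   constraints, where [b = 0]. *)
pose k := (1 - b)^-1; have k0 : 0 < k by rewrite invr_gt0.
have kb : 1 + k * b = k by rewrite /k; field; rewrite gt_eqF.
have hx : subdiff f x (g + k *: (a + b *: g)).
  apply: subdiff_local => //; first by rewrite fx.
  apply: filterS epi => y yepi.
  have := gx y; have := pf.1 y; case fy: (f y) => [s| |]//; last by move=> _ _; rewrite leey.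
  rewrite fx -!EFinD !lee_fin => _ gy.
  have ys : dot a (y - x) + b * (s - r) <= 0.
    have := yepi s; rewrite fy lexx => /(_ isT).
    by rewrite -act dotBr => ?; lra.
  rewrite !(dotDl, dotZl).
  have k_ge0 := ltW k0.
  have := mulr_ge0 k_ge0 (_ : 0 <= - (dot a (y - x) + b * (s - r))).
  rewrite oppr_ge0 => /(_ ys) e1.
  have := mulr_ge0 k_ge0 (_ : 0 <= s - r - dot g (y - x)).
  have -> : 0 <= s - r - dot g (y - x) by lra.
  move=> /(_ isT); rewrite -{1}kb => e2; lra.
have := wT _ (par_sub _ _ _ hx gx).
rewrite addrC addKr dotZr dotDr dotZr dotC (dotC w g) => /eqP.
by rewrite mulf_eq0 gt_eqF//= => /eqP.
Qed.

(* Inactive constraints of the polyhedron are irrelevant near [(x, f x)]; along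
   [d] the active ones stay saturated by [active_constraint_orth]. *)
Lemma polyhedral_linear f x g : Defs.proper f -> convex_fun f ->
  locally_polyhedral f x -> subdiff f x g ->
  \forall d \near (0 : V), orth (par (subdiff f x)) d ->
    (f (x + d)%R <= f x + (dot g d)%:E)%E.
Proof.
move=> pf cf [p [m [a [b [c pE]]]] fp] gx.
have := subdiff_fin_num f x g pf gx; case fx : (f x) => [r| |]// _.
have epiE y s : (p y <= s%:E)%E <-> forall i, dot (a i) y + b i * s <= c i.
  by rewrite (_ : (p y <= s%:E)%E = epigraph p (y, s) :> Prop)// pE.
have xr : forall i, dot (a i) x + b i * r <= c i.
  by apply/epiE; rewrite -(nbhs_singleton fp) fx.
have sat i : \forall d \near (0 : V), orth (par (subdiff f x)) d ->
    dot (a i) (x + d) + b i * (r + dot g d) <= c i.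
  have [act|inact] := eqVneq (dot (a i) x + b i * r) (c i).
    near=> d => dT; rewrite dotDr mulrDr addrACA act gerDl.
    rewrite (active_constraint_orth f x g d (a i) (b i) (c i) r)//.
    by apply: filterS fp => y -> s /epiE.
  have lim (F : set_system V) : Filter F -> d @[d --> F] --> (0 : V) ->
      dot (a i) (x + d) + b i * (r + dot g d) @[d --> F] -->
      dot (a i) x + b i * r.
    move=> FF F0.
    rewrite -{2}[x]addr0 -{2}[r]addr0 -(dot0r g).
    have xd : x + d @[d --> F] --> x + 0 by apply: cvgD => //; exact: cvg_cst.
    apply: cvgD; first exact: (cvg_dot _ _ _ _ _ (cvg_cst (a i)) xd).
    apply: cvgM; first exact: cvg_cst.
    by apply: cvgD; [exact: cvg_cst|exact: (cvg_dot _ _ _ _ _ (cvg_cst g) F0)].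
  have lt : dot (a i) x + b i * r < c i by rewrite lt_neqAle inact xr.
  near=> d => _; apply: ltW; near: d.
  exact: (cvgr_lt _ (lim _ (nbhs_filter (0 : V)) cvg_id) _ lt).
have fp0 : \forall d \near (0 : V), f (x + d) = p (x + d).
  by have /(@nbhs0P _ _ [set y | f y = p y]) := fp.
near=> d => dT; rewrite (_ : f (x + d) = p (x + d)); last by near: d.
rewrite -EFinD; apply/epiE => i; move: i dT.
by near: d; exact: filter_forall.
Unshelve. all: by end_near. Qed.

(** All subgradients at [x] agree along [d], so the upper bound on [f (x + d)] obtained from [g]
    holds with every [h], on a neighbourhood independent of [h]. *)
Lemma subdiff_translate f x g : Defs.proper f -> convex_fun f ->
  locally_polyhedral f x -> subdiff f x g ->
  \forall d \near (0 : V), orth (par (subdiff f x)) d ->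
    subdiff f x `<=` subdiff f (x + d).
Proof.
move=> pf cf lf gx.
apply: filterS (polyhedral_linear f x g pf cf lf gx) => d fd dT h hx y.
have /eqP := dT _ (par_sub _ _ _ gx hx); rewrite dotBr !(dotC d) subr_eq0 => /eqP gh.
apply: le_trans (hx y).
have := fd dT; have := subdiff_fin_num f x g pf gx; case: (f x) => [r| |]// _.
have := pf.1 (x + d); case: (f (x + d)) => [s| |]// _.
rewrite -!EFinD !lee_fin gh opprD addrA (dotBr _ d) => ?; lra.
Qed.

(** Testing the minimality of [y] at [x] and adding [gamma] times the subgradient inequality bounds
    half the squared norm of [y - x] by [0]. *)
Lemma prox_unique (gamma : K) f w x y h : Defs.proper f -> 0 < gamma ->
  subdiff f x h -> w - x = gamma *: h -> prox gamma f w y -> y = x.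
Proof.
move=> pf g0 hx wx /(_ x); have := hx y.
have := subdiff_fin_num f x h pf hx; case: (f x) => [r| |]// _.
have := pf.1 y; case: (f y) => [s| |]//.
- move=> _; rewrite -!EFinM -!EFinD !lee_fin !sqr_enorm => e1 e2.
  apply/eqP; rewrite -subr_eq0 -dot_eq0 eq_le dot_ge0 andbT.
  have yw : y - w = (y - x) - gamma *: h by rewrite -wx opprB addrA subrK.
  have xw : x - w = - (gamma *: h) by rewrite -wx opprB.
  move: e2; rewrite yw xw; move: (y - x) e1 => v e1.
  rewrite !(dotBl, dotBr, dotNl, dotNr, dotZl, dotZr) (dotC v h).
  have := mulr_ge0 (ltW g0) (_ : 0 <= s - (r + dot h v)).
  rewrite subr_ge0 => /(_ e1) ? ?; lra.
- by move=> _ _; rewrite gt0_muley ?lte_fin// addye.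
Qed.

(* Nondegeneracy keeps the candidate [xs + oproj T (w - ws)] optimal: the dual
   variable moves inside [aff (subdiff f xs)], hence stays in the subdifferential
   at [xs], hence in the one at the candidate. *)
Lemma prox_locally_affine (gamma : K) f (xs ws h : V) T :
  0 < gamma -> Defs.proper f -> convex_fun f -> locally_polyhedral f xs ->
  [set` T] = orth (par (subdiff f xs)) ->
  ri (subdiff f xs) h -> ws - xs = gamma *: h ->
  \forall w \near ws, forall y, prox gamma f w y -> y = xs + oproj T (w - ws).
Proof.
move=> g0 pf cf lf TE [hx hri] wsE.
have [p0 q0] : (oproj T (w - ws) @[w --> nbhs ws] --> (0 : V)) /\
    (h + gamma^-1 *: ((w - ws) - oproj T (w - ws)) @[w --> nbhs ws] --> h).
  suff lim (F : set_system V) : Filter F -> w @[w --> F] --> ws ->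
      (oproj T (w - ws) @[w --> F] --> (0 : V)) /\
      (h + gamma^-1 *: ((w - ws) - oproj T (w - ws)) @[w --> F] --> h).
    by apply: lim; exact: cvg_id.
  move=> FF Fw.
  have w0 : w - ws @[w --> F] --> (0 : V).
    by rewrite -(subrr ws); apply: cvgB => //; exact: cvg_cst.
  have p0 : oproj T (w - ws) @[w --> F] --> (0 : V).
    by rewrite -[X in _ --> X](oproj_id T 0 (mem0v _)); exact: cvg_oproj.
  split=> //; rewrite -[X in _ --> X]addr0 -(scaler0 _ gamma^-1) -(subr0 (0 : V)).
  by apply: cvgD; [exact: cvg_cst|apply: cvgZl_tmp; exact: cvgB].
near=> w => y py.
apply: (prox_unique gamma f w _ y (h + gamma^-1 *: ((w - ws) - oproj T (w - ws)))) => //.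
  have tr : orth (par (subdiff f xs)) (oproj T (w - ws)) ->
      subdiff f xs `<=` subdiff f (xs + oproj T (w - ws)).
    by near: w; exact: (p0 _ (subdiff_translate f xs h pf cf lf hx)).
  apply: tr; first by rewrite -TE; exact: oproj_in.
  have : aff (subdiff f xs) (h + gamma^-1 *: (w - ws - oproj T (w - ws))).
    apply: (aff_add_orth _ _ T _ hx TE) => v vT.
    by rewrite dotZl oproj_orth// mulr0.
  by near: w; exact: (q0 _ hri).
rewrite scalerDr scalerA divff ?gt_eqF// scale1r -wsE.
by apply/rowP => i; rewrite !mxE; ring.
Unshelve. all: by end_near. Qed.

End ProximalMap.

(** * Algebra of the Douglas-Rachford operator *)

Section DouglasRachfordOperator.
Context {K : realType} {n : nat}.
Local Notation V := 'rV[K]_n.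
Implicit Types (u v w x y : V) (T : {vspace V}).

Lemma dot_oproj_compl T1 x y :
  dot (x - oproj T1 x) y = dot x (y - oproj T1 y).
Proof. by rewrite dotBl dotBr dot_oproj. Qed.

Lemma MDRB T1 T2 x y : MDR T1 T2 (x - y) = MDR T1 T2 x - MDR T1 T2 y.
Proof. by rewrite /MDR !oprojB; apply/rowP => i; rewrite !mxE; ring. Qed.

(** Projections are self-adjoint, so taking the adjoint reverses each product and exchanges the two
    subspaces. *)
Lemma MDR_adjoint T1 T2 w y : dot (MDR T1 T2 w) y = dot w (MDR T2 T1 y).
Proof. by rewrite /MDR dotDl dotDr !dot_oproj !dot_oproj_compl. Qed.

Lemma sqr_MDR T1 T2 w (a := oproj T2 w) (b := w - oproj T2 w) :
  dot (MDR T1 T2 w) (MDR T1 T2 w) =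
  dot (oproj T1 a) (oproj T1 a) + dot (b - oproj T1 b) (b - oproj T1 b).
Proof.
rewrite /MDR -/a -/b.
have := oproj_orth T1 b _ (oproj_in T1 a).
move: (b - _) (oproj T1 a) => p q pq.
by rewrite !(dotDl, dotDr) (dotC q p) pq addr0 add0r.
Qed.

Lemma sqr_oproj_compl T1 b :
  dot (b - oproj T1 b) (b - oproj T1 b) = dot b b - dot (oproj T1 b) (oproj T1 b).
Proof.
rewrite !(dotBl, dotBr) (dotC b (oproj T1 b)) (dot_oprojl T1 b b); ring.
Qed.

(* The symmetric part of [MDR T1 T2] is [MDR^* MDR]. *)
Lemma MDR_dot_self T1 T2 w :
  dot (MDR T1 T2 w) w = dot (MDR T1 T2 w) (MDR T1 T2 w).
Proof.
rewrite sqr_MDR sqr_oproj_compl /MDR.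
set a := oproj T2 w; set b := w - a.
have ab : dot b a = 0 by exact/oproj_orth/oproj_in.
have -> : dot (oproj T1 a + (b - oproj T1 b)) w =
    dot (oproj T1 a + (b - oproj T1 b)) (a + b) by rewrite [a + b]addrC subrK.
move: b ab => b ab; move: a ab => a ab.
rewrite !(dotBl, dotDl, dotDr) ab !(dot_oprojl T1 _ a) !(dot_oprojl T1 _ b).
rewrite (dotC (oproj T1 b) (oproj T1 a)); ring.
Qed.

(** Both sides equal [dot (MDR T1 T2 w) w], a quadratic form that the operator shares with its
    adjoint. *)
Lemma MDR_normal T1 T2 w :
  dot (MDR T1 T2 w) (MDR T1 T2 w) = dot (MDR T2 T1 w) (MDR T2 T1 w).
Proof.
apply: etrans (esym (MDR_dot_self T1 T2 w)) _.
by apply: etrans (MDR_dot_self T2 T1 w); rewrite MDR_adjoint dotC.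
Qed.

(** Cauchy-Schwarz for [w] and [MDR T2 T1 (MDR T1 T2 w)]; normality then replaces the outer adjoint
    by [MDR T1 T2]. Successive norm ratios are therefore nondecreasing. *)
Lemma MDR_log_convex T1 T2 w :
  dot (MDR T1 T2 w) (MDR T1 T2 w) ^+ 2 <=
  dot w w * dot (MDR T1 T2 (MDR T1 T2 w)) (MDR T1 T2 (MDR T1 T2 w)).
Proof.
have := cauchy_schwarz w (MDR T2 T1 (MDR T1 T2 w)).
rewrite -(MDR_normal T1 T2 (MDR T1 T2 w)).
by rewrite -(MDR_adjoint T1 T2 w (MDR T1 T2 w)).
Qed.

Lemma angle_MDR T1 T2 w :
  angle (MDR T1 T2 w) w = acos (enorm (MDR T1 T2 w) / enorm w).
Proof.
rewrite /angle MDR_dot_self -sqr_enorm; congr acos.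
have [->|m0] := eqVneq (enorm (MDR T1 T2 w)) 0.
  by rewrite expr0n !mul0r.
by rewrite invfM expr2 mulrA mulfK.
Qed.

(** With [MDR_cap_orth], this supplies the fixed vectors to which velocities tending to [0] must be
    orthogonal. *)
Lemma MDR_cap T1 T2 w : w \in T1 -> w \in T2 -> MDR T1 T2 w = w.
Proof.
by move=> w1 w2; rewrite /MDR (oproj_id T2)// subrr !oproj_id ?mem0v// subrr addr0.
Qed.

Lemma MDR_cap_orth T1 T2 w :
  orth [set` T1] w -> orth [set` T2] w -> MDR T1 T2 w = w.
Proof.
move=> w1 w2; rewrite /MDR (oproj_orth0 T2)// oproj_id ?mem0v// !subr0.
by rewrite oproj_orth0// add0r subr0.
Qed.

End DouglasRachfordOperator.

(** * Friedrichs pairs and the contraction factor of the operator *)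

Section FriedrichsAngle.
Context {K : realType} {n : nat}.
Local Notation V := 'rV[K]_n.
Implicit Types (u v w x y s t : V) (T : {vspace V}).

Lemma orth_closed (S : set V) : closed (orth S).
Proof.
have -> : orth S = \bigcap_(w in S) ((fun v => dot v w) @^-1` [set x | x = 0]).
  by apply/seteqP; split=> v Sv w /Sv.
apply: closed_bigI => w _; apply: preimage_closed; last exact: closed_eq.
move=> v _; exact: (@cvg_dot _ _ _ _ (nbhs_filter v) id (fun=> w) _ _ cvg_id (cvg_cst w)).
Qed.

Lemma feasible_nonempty T T0 : ~~ (T <= T0)%VS ->
  exists u, [/\ u \in T, orth [set` (T :&: T0)%VS] u & dot u u = 1].
Proof.
move=> /subvPn[w wT wT0].
pose d := w - oproj (T :&: T0) w.
have := oproj_in (T :&: T0) w; rewrite memv_cap => /andP[pT pT0].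
have d0 : d != 0.
  by apply: contra wT0; rewrite subr_eq0 => /eqP ->.
exists ((enorm d)^-1 *: d); split.
- by rewrite memvZ// memvB.
- by move=> s sT; rewrite dotZl oproj_orth// mulr0.
- rewrite dotZl dotZr mulrA -invfM -expr2 sqr_enorm mulVf//.
  by rewrite dot_eq0.
Qed.

Lemma feasible_compact T (S : set V) :
  compact [set u | [/\ u \in T, orth S u & dot u u = 1]].
Proof.
apply: bounded_closed_compact.
  exists 1; split; first exact: num_real.
  move=> M M1 u [_ _ u1]; apply: le_trans (ltW M1).
  rewrite [leLHS]/Num.norm /= mx_normrE; apply/bigmax_leP; split=> // -[i j] _ /=.
  rewrite -(@ler_pXn2r _ 2)// ?nnegrE// expr1n -u1 real_normK ?num_real//.
  rewrite (ord1 i) expr2 /dot (bigD1 j)//= lerDl sumr_ge0// => k _.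
  by rewrite -expr2 sqr_ge0.
(* Writing [T] as its double orthogonal makes the set an intersection of closed conditions. *)
have -> : [set u | [/\ u \in T, orth S u & dot u u = 1]] =
    orth (orth [set` T]) `&` orth S `&` ((fun u => dot u u) @^-1` [set x | x = 1]).
  apply/seteqP; split=> u; first by move=> [uT Su u1]; split=> //; split=> // w; rewrite dotC; exact.
  by move=> [[uT Su] u1]; split=> //; exact: orth_oproj_in.
apply: closedI; first by apply: closedI; exact: orth_closed.
apply: preimage_closed; last exact: closed_eq.
move=> v _; exact: (@cvg_dot _ _ _ _ (nbhs_filter v) id id _ _ cvg_id cvg_id).
Qed.

(** Each non-inclusion makes one unit sphere nonempty; both spheres are compact, so the inner
    product attains its maximum on their product. *)
Lemma friedrichs_pair_exists T1 T2 : ~~ (T1 <= T2)%VS -> ~~ (T2 <= T1)%VS ->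
  exists u v, friedrichs_pair T1 T2 u v.
Proof.
move=> /feasible_nonempty[u0 u0P] /feasible_nonempty[v0]; rewrite capvC => v0P.
pose A T := [set u | [/\ u \in T, orth [set` (T1 :&: T2)%VS] u & dot u u = 1]].
have AB0 : A T1 `*` A T2 !=set0 by exists (u0, v0).
have ABc : compact (A T1 `*` A T2) by apply: compact_setX; exact: feasible_compact.
have dc : continuous (fun p : V * V => dot p.1 p.2).
  move=> p.
  exact: (@cvg_dot _ _ _ _ (nbhs_filter p) _ _ _ _ cvg_fst cvg_snd).
have [[u v] uv uv_max] := compact_EVT_max AB0 ABc (continuous_subspaceT dc).
have feasE x y : friedrichs_feasible T1 T2 x y <-> (A T1 `*` A T2) (x, y).
  split=> [[x1 x2 /enorm_eq1 x3 [y1 y2 /enorm_eq1 y3]]|[[x1 x2 x3] [y1 y2 y3]]] //.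
  by split=> //; [exact/enorm_eq1|split=> //; exact/enorm_eq1].
exists u, v; split; first by apply/feasE; rewrite inE in uv.
by move=> x y /feasE xy; apply: (uv_max (x, y)); rewrite inE.
Qed.

Lemma friedrichs_pairC T1 T2 u v :
  friedrichs_pair T1 T2 u v -> friedrichs_pair T2 T1 v u.
Proof.
have feasC A B x y : friedrichs_feasible A B x y -> friedrichs_feasible B A y x.
  by move=> [x1 x2 x3 [y1 y2 y3]]; split; rewrite 1?capvC.
move=> [/feasC uv mx]; split=> // x y /feasC /mx.
by rewrite dotC (dotC u).
Qed.

Section Pair.
Variables (T1 T2 : {vspace V}) (u v : V).
Hypothesis uv : friedrichs_pair T1 T2 u v.
Let c := dot u v.

Let u1 : u \in T1. Proof. by case: uv => -[]. Qed.
Let v2 : v \in T2. Proof. by case: uv => -[_ _ _ []]. Qed.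
Let uo : orth [set` (T1 :&: T2)%VS] u. Proof. by case: uv => -[]. Qed.
Let vo : orth [set` (T1 :&: T2)%VS] v. Proof. by case: uv => -[_ _ _ []]. Qed.
Let uu : dot u u = 1. Proof. by case: uv => -[_ _ /enorm_eq1]. Qed.
Let vv : dot v v = 1. Proof. by case: uv => -[_ _ _ [_ _ /enorm_eq1]]. Qed.

Lemma friedrichs_cos_ge0 : 0 <= c.
Proof.
have : dot u (- v) <= dot u v.
  apply: uv.2; split=> //; first exact/enorm_eq1.
  split; first by rewrite memvN.
    by move=> w /vo vw; rewrite dotNl vw oppr0.
  by apply/enorm_eq1; rewrite dotNl dotNr opprK.
by rewrite dotNr -/c => ?; lra.
Qed.

(** A cosine equal to [1] would force [u = v], a unit vector both in [T1 :&: T2] and orthogonal to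
    it. *)
Lemma friedrichs_cos_lt1 : c < 1.
Proof.
have := dot_ge0 (u - v); rewrite !(dotBl, dotBr) uu vv (dotC v) -/c => h.
have c1 : c <= 1 by lra.
rewrite lt_neqAle c1 andbT; apply/eqP => cE.
have /eqP : dot (u - v) (u - v) = 0.
  by rewrite !(dotBl, dotBr) uu vv (dotC v) -/c cE !subrr.
rewrite dot_eq0 subr_eq0 => /eqP uvE.
have u12 : u \in (T1 :&: T2)%VS by rewrite memv_cap u1 uvE v2.
by have := uo _ u12; rewrite uu => /eqP; rewrite oner_eq0.
Qed.

Lemma friedrichs_dot_le s t : s \in T1 -> orth [set` (T1 :&: T2)%VS] s ->
  t \in T2 -> orth [set` (T1 :&: T2)%VS] t ->
  dot s t <= c * (enorm s * enorm t).
Proof.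
move=> sT so tT to.
have [->|s0] := eqVneq s 0.
  by rewrite dot0l mulr_ge0 ?friedrichs_cos_ge0// mulr_ge0 ?enorm_ge0.
have [->|t0] := eqVneq t 0.
  by rewrite dot0r mulr_ge0 ?friedrichs_cos_ge0// mulr_ge0 ?enorm_ge0.
have es : 0 < enorm s by rewrite enorm_gt0.
have et : 0 < enorm t by rewrite enorm_gt0.
have unit w : 0 < enorm w -> enorm ((enorm w)^-1 *: w) = 1.
  move=> ew; apply/enorm_eq1.
  by rewrite dotZl dotZr mulrA -invfM -expr2 -sqr_enorm mulVf// expf_neq0// gt_eqF.
have orthZ (a : K) w : orth [set` (T1 :&: T2)%VS] w -> orth [set` (T1 :&: T2)%VS] (a *: w).
  by move=> wo y /wo wy; rewrite dotZl wy mulr0.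
have : dot ((enorm s)^-1 *: s) ((enorm t)^-1 *: t) <= dot u v.
  apply: uv.2; split; [exact: memvZ|exact: orthZ|exact: unit|split].
  - exact: memvZ.
  - exact: orthZ.
  - exact: unit.
rewrite dotZl dotZr mulrA -invfM mulrC ler_pdivrMr ?mulr_gt0//.
Qed.

(** The squared norm of [oproj T1 y] is its inner product with [y], and [oproj T1 y] stays
    orthogonal to [T1 :&: T2], so [friedrichs_dot_le] applies. *)
Lemma oproj_contract y : y \in T2 -> orth [set` (T1 :&: T2)%VS] y ->
  dot (oproj T1 y) (oproj T1 y) <= c ^+ 2 * dot y y.
Proof.
move=> yT yo; rewrite -!sqr_enorm -exprMn ler_pXn2r ?nnegrE ?mulr_ge0 ?enorm_ge0//;
  last exact: friedrichs_cos_ge0.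
have [->|p0] := eqVneq (oproj T1 y) 0.
  by rewrite /enorm dot0l sqrtr0 mulr_ge0 ?friedrichs_cos_ge0 ?sqrtr_ge0.
have ep : 0 < enorm (oproj T1 y) by rewrite enorm_gt0.
rewrite -(ler_pM2l ep) -expr2 sqr_enorm -dot_oprojl mulrCA.
apply: friedrichs_dot_le => //; first exact: oproj_in.
move=> w wT; rewrite dot_oproj oproj_id ?yo//.
by move: wT; rewrite /= memv_cap => /andP[].
Qed.

(** Equality case of [oproj_contract]: the squared distance to [c *: u] is the squared norm of
    [oproj T1 v] minus [c ^+ 2], hence at most [0]. *)
Lemma oproj_friedrichs : oproj T1 v = c *: u.
Proof.
apply/eqP; rewrite -subr_eq0 -dot_eq0 eq_le dot_ge0 andbT.
have := oproj_contract v v2 vo.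
have : dot (oproj T1 v) u = c by rewrite dot_oproj oproj_id// dotC.
rewrite vv !(dotBl, dotBr, dotZl, dotZr) uu => e.
by rewrite (dotC u) e mulr1 => ?; lra.
Qed.

End Pair.

Section Contraction.
Variables (T1 T2 : {vspace V}) (u v : V).
Hypothesis uv : friedrichs_pair T1 T2 u v.
Let c := dot u v.

Let vu : friedrichs_pair T2 T1 v u. Proof. exact: friedrichs_pairC. Qed.
Let c_ge0 : 0 <= c. Proof. exact: (friedrichs_cos_ge0 T1 T2). Qed.
Let c_lt1 : c < 1. Proof. exact: (friedrichs_cos_lt1 T1 T2). Qed.

(* [y] lies in [T1 + T2]; writing [y = t1 + t2] gives
   [|y|^2 = dot (oproj T1 y) t1] and [|y|^2 >= (1 - c^2) |t1|^2]. *)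
Lemma oproj_compl_contract y : orth [set` T2] y ->
  (forall s, orth [set` T1] s -> orth [set` T2] s -> dot y s = 0) ->
  dot (y - oproj T1 y) (y - oproj T1 y) <= c ^+ 2 * dot y y.
Proof.
move=> y2 ys; rewrite sqr_oproj_compl.
have c0 := c_ge0; have c1 := c_lt1.
have : y \in (T1 + T2)%VS.
  have yo := oproj_orth (T1 + T2) y.
  have sub T : (T <= T1 + T2)%VS -> orth [set` T] (y - oproj (T1 + T2) y).
    by move=> /subvP TS s /TS; exact: yo.
  have := ys _ (sub _ (addvSl _ _)) (sub _ (addvSr _ _)).
  have := yo _ (oproj_in (T1 + T2) y); rewrite dotC => e1 e2.
  have : dot (y - oproj (T1 + T2) y) (y - oproj (T1 + T2) y) = 0.
    by rewrite [LHS]dotBl e1 e2 subrr.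
  by move=> /eqP; rewrite dot_eq0 subr_eq0 => /eqP ->; exact: oproj_in.
move=> /memv_addP[t0 t0T [t0' t0'T yE0]].
(* Moving the common component [p] from [t0] to [t0'] keeps the sum and makes the first term
   orthogonal to [T1 :&: T2], as [oproj_contract] demands. *)
pose p := oproj (T1 :&: T2) t0.
have := oproj_in (T1 :&: T2) t0; rewrite -/p memv_cap => /andP[p1 p2].
pose t := t0 - p; pose t' := t0' + p.
have tT : t \in T1 by rewrite memvB.
have t'T : t' \in T2 by rewrite memvD.
have to : orth [set` (T1 :&: T2)%VS] t by exact: oproj_orth.
have yE : y = t + t' by rewrite yE0 /t /t' addrACA addNr addr0.
move: t t' tT t'T to yE => t t' tT t'T to yE.
have yt : dot y y = dot (oproj T1 y) t.
  by rewrite dot_oproj (oproj_id T1 t tT) {2}yE dotDr (y2 _ t'T) addr0.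
have := cauchy_schwarz (oproj T1 y) t; rewrite -yt.
have : dot y y = dot t t - dot (oproj T2 t) (oproj T2 t).
  have : oproj T2 y = 0 by exact: oproj_orth0.
  rewrite {1}yE oprojD (oproj_id T2 t')// => /eqP; rewrite addrC addr_eq0 => /eqP t'E.
  rewrite yt dot_oproj (oproj_id T1 t tT) {1}yE t'E.
  by rewrite dotDl dotNl (dot_oprojl T2 t t).
have := oproj_contract T2 T1 v u vu t tT.
rewrite capvC (dotC v u) -/c => /(_ to).
move: (dot_ge0 y) (dot_ge0 t) (dot_ge0 (oproj T1 y)).
move: (dot y y) (dot t t) (dot (oproj T1 y) _) (dot (oproj T2 t) _).
move=> Y S P Q Y0 S0 P0 QS YE YPS.
have c21 : c ^+ 2 < 1 by rewrite expr_lt1.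
have [Y00|Yn0] := eqVneq Y 0; first by rewrite Y00 mulr0; lra.
have Yp : 0 < Y by rewrite lt_def Yn0.
rewrite -subr_ge0 -(pmulr_rge0 _ Yp).
have h1 : 0 <= P * (Y - (1 - c ^+ 2) * S) by apply: mulr_ge0 => //; lra.
have h2 : 0 <= (1 - c ^+ 2) * (P * S - Y ^+ 2) by apply: mulr_ge0; lra.
lra.
Qed.

(** Pythagoras on both sides: the component of [w] in [T2] and its residual are each contracted by
    the factor [c]. *)
Lemma MDR_contract w : orth [set` (T1 :&: T2)%VS] w ->
  (forall s, orth [set` T1] s -> orth [set` T2] s -> dot w s = 0) ->
  dot (MDR T1 T2 w) (MDR T1 T2 w) <= c ^+ 2 * dot w w.
Proof.
move=> wo ws; rewrite sqr_MDR.
have -> : dot w w = dot (oproj T2 w) (oproj T2 w) +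
    dot (w - oproj T2 w) (w - oproj T2 w).
  by rewrite sqr_oproj_compl addrC subrK.
rewrite mulrDr lerD//.
- apply: (oproj_contract T1 T2 u v uv); first exact: oproj_in.
  move=> s sT; rewrite dot_oproj oproj_id ?wo//.
  by move: sT; rewrite /= memv_cap => /andP[].
- apply: oproj_compl_contract; first exact: oproj_orth.
  move=> s s1 s2; rewrite dotBl ws// dotC s2 ?subrr//; exact: oproj_in.
Qed.

(* [1 - c^2] times the squared norm of the projection of [w] onto [<u, v>] *)
Definition plane_form (w : V) : K :=
  dot w u ^+ 2 + dot w v ^+ 2 - 2 * c * (dot w u * dot w v).

Lemma plane_form_MDR w : plane_form (MDR T1 T2 w) = c ^+ 2 * plane_form w.
Proof.
have P1v : oproj T1 v = c *: u := oproj_friedrichs T1 T2 u v uv.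
have P2u : oproj T2 u = c *: v.
  by rewrite (oproj_friedrichs T2 T1 v u vu) (dotC v u).
have u1 : u \in T1 by case: uv => -[].
have v2 : v \in T2 by case: vu => -[].
(* The adjoint preserves the plane of [u] and [v]; in this basis its determinant is [c ^+ 2] and its
   trace [2 * c ^+ 2], as for [c] times the rotation by the Friedrichs angle. *)
have mu : MDR T2 T1 u = c *: v.
  by rewrite /MDR (oproj_id T1 u)// subrr P2u (oproj_id T2 0) ?mem0v// subrr addr0.
have mv : MDR T2 T1 v = (2 * c ^+ 2) *: v - c *: u.
  rewrite /MDR P1v oprojB oprojZ P2u (oproj_id T2 v)//.
  by apply/rowP => i; rewrite !mxE; ring.
rewrite /plane_form (MDR_adjoint T1 T2 w u) (MDR_adjoint T1 T2 w v) mu mv.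
rewrite dotBr !dotZr; ring.
Qed.

(** With [a], [b] the two inner products, [2 (a^2 + b^2)] minus the form is
    [c (a + b)^2 + (1 - c)(a^2 + b^2)], and [a^2], [b^2] are at most [dot w w]. *)
Lemma plane_form_le w : plane_form w <= 4 * dot w w.
Proof.
have unit x : enorm x = 1 -> dot w x ^+ 2 <= dot w w.
  by move=> /enorm_eq1 x1; have := cauchy_schwarz w x; rewrite x1 mulr1.
have : dot w v ^+ 2 <= dot w w by apply: unit; case: vu => -[].
have : dot w u ^+ 2 <= dot w w by apply: unit; case: uv => -[].
have c0 := c_ge0; have c1 := c_lt1.
rewrite /plane_form; move: (dot w u) (dot w v) (dot w w) => a b s as_ bs.
have := mulr_ge0 c0 (sqr_ge0 (a + b)).
have := mulr_ge0 (ltW (_ : 0 < 1 - c)) (addr_ge0 (sqr_ge0 a) (sqr_ge0 b)).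
by rewrite subr_gt0 => /(_ c1) ? ?; lra.
Qed.

(** The form equals [(1 - c)(a^2 + b^2) + c (a - b)^2]. *)
Lemma plane_form_gt0 w : dot w u != 0 \/ dot w v != 0 -> 0 < plane_form w.
Proof.
have c0 := c_ge0; have c1 := c_lt1.
rewrite /plane_form; move: (dot w u) (dot w v) => a b ab.
have : 0 < a ^+ 2 + b ^+ 2.
  case: ab => [a0|b0].
    by rewrite ltr_pwDl ?sqr_ge0// lt_def sqrf_eq0 a0 sqr_ge0.
  by rewrite ltr_wpDl ?sqr_ge0// lt_def sqrf_eq0 b0 sqr_ge0.
rewrite -(pmulr_rgt0 _ (_ : 0 < 1 - c)) ?subr_gt0//.
have := mulr_ge0 c0 (sqr_ge0 (a - b)) => ? ?; lra.
Qed.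

End Contraction.

Lemma friedrichs_angle_acos T1 T2 u v : friedrichs_pair T1 T2 u v ->
  [/\ 0 < acos (dot u v) <= pi / 2, cos (acos (dot u v)) = dot u v &
      0 < dot u v -> acos (dot u v) < pi / 2].
Proof.
move=> uv; have c0 := friedrichs_cos_ge0 _ _ _ _ uv.
have c1 := friedrichs_cos_lt1 _ _ _ _ uv.
have cI : dot u v \in `[(-1), 1] by rewrite in_itv/=; apply/andP; split; lra.
have cE := acosK cI; have a0 : 0 < acos (dot u v) by apply: acos_gt0; apply/andP; split; lra.
have api : acos (dot u v) <= pi by apply: acos_lepi; apply/andP; split; lra.
have ale : acos (dot u v) <= pi / 2.
  rewrite leNgt; apply/negP => ha.
  have : 0 < cos (pi - acos (dot u v)) by apply: cos_gt0_pihalf; apply/andP; split; lra.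
  by rewrite addrC cosDpi cosN cE => ?; lra.
split=> //; first by rewrite a0.
move=> cp; rewrite lt_neqAle ale andbT; apply/eqP => aE.
by move: cE; rewrite aE cos_pihalf => e; move: cp; rewrite -e ltxx.
Qed.

End FriedrichsAngle.

(* The ratios increase by log-convexity; a limit below [rho] would contradict the
   geometric lower bound. *)
Lemma cvg_ratio (K : realType) (a : nat -> K) (rho delta : K) :
  (forall k, 0 < a k) -> 0 < rho -> 0 < delta ->
  (forall k, a k.+1 ^+ 2 <= a k * a k.+2) ->
  (forall k, a k.+1 <= rho * a k) ->
  (forall k, delta * rho ^+ k <= a k) ->
  a k.+1 / a k @[k --> \oo] --> rho.
Proof.
move=> a0 rho0 delta0 lc ub lb.
pose r k := a k.+1 / a k.
have r_ge0 k : 0 <= r k by rewrite divr_ge0// ltW.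
have r_incr : {homo r : k l / (k <= l)%N >-> k <= l}.
  apply: homo_leq; [exact: lexx|exact: le_trans|move=> k].
  rewrite /r ler_pdivrMr// mulrAC ler_pdivlMr//.
  by rewrite -expr2 mulrC; exact: lc.
have r_le k : r k <= rho by rewrite /r ler_pdivrMr.
have r_cvg : cvgn r.
  by apply: nondecreasing_is_cvgn => //; exists rho => _ [k _ <-].
pose l := limn r.
have r_l k : r k <= l by exact: nondecreasing_cvgn_le.
have l_ge0 : 0 <= l by apply: le_trans (r_l 0%N).
have l_le : l <= rho by apply: limr_le => //; exact: nearW.
suff <- : l = rho by exact: r_cvg.
apply/eqP; rewrite eq_le l_le leNgt; apply/negP => l_lt.
have a_le k : a k <= a 0%N * l ^+ k.
  elim: k => [|k IH]; first by rewrite expr0 mulr1.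
  rewrite exprSr mulrA; apply: le_trans (_ : a k * l <= _).
    by rewrite mulrC -ler_pdivrMr//; exact: r_l.
  by rewrite ler_wpM2r.
have q1 : `|l / rho| < 1.
  by rewrite ger0_norm ?divr_ge0 ?(ltW rho0)// ltr_pdivrMr// mul1r.
have := cvg_expr q1 => /cvgr_lt /(_ (delta / a 0%N)).
rewrite divr_gt0// => /(_ isT) [k _ /(_ k (leqnn k))] /=.
rewrite expr_div_n ltr_pdivrMr ?exprn_gt0// mulrAC ltr_pdivlMr// mulrC.
by rewrite ltNge (le_trans (lb k) (a_le k)).
Qed.

(** * Velocities and angles once the iteration is linear *)

Section LinearRegime.
Context {K : realType} {n : nat}.
Local Notation V := 'rV[K]_n.
Variables (T1 T2 : {vspace V}) (z : nat -> V) (zs : V) (N : nat).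
Hypothesis z_cvg : z @ \oo --> zs.
Hypothesis vel_MDR : forall k, (N <= k)%N -> vel z k.+1 = MDR T1 T2 (vel z k).

Lemma vel_cvg0 : vel z k @[k --> \oo] --> (0 : V).
Proof.
rewrite -(cvg_shiftS (vel z)) -(subrr zs).
by apply: cvgB => //; rewrite cvg_shiftS.
Qed.

(** The inner product with a vector fixed by the adjoint is constant along the velocities, which
    tend to [0]. *)
Lemma vel_orth_fixed f k : MDR T2 T1 f = f -> (N <= k)%N -> dot (vel z k) f = 0.
Proof.
move=> ff Nk.
have cst j : dot (vel z (j + k)) f = dot (vel z k) f.
  elim: j => // j <-; rewrite addSn vel_MDR; last by rewrite (leq_trans Nk) ?leq_addl.
  by rewrite MDR_adjoint ff.
have : dot (vel z j) f @[j --> \oo] --> dot (0 : V) f.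
  by apply: cvg_dot; [exact: vel_cvg0|exact: cvg_cst].
rewrite -(cvg_shiftn k) dot0l; under eq_cvg do rewrite /= cst.
move=> /(cvg_lim (@Rhausdorff K)); rewrite lim_cst//; exact: Rhausdorff.
Qed.

Lemma vel_contract u v k : friedrichs_pair T1 T2 u v -> (N <= k)%N ->
  dot (vel z k.+1) (vel z k.+1) <= dot u v ^+ 2 * dot (vel z k) (vel z k).
Proof.
move=> uv Nk; rewrite vel_MDR//; apply: MDR_contract => // f.
  by rewrite /= memv_cap => /andP[f1 f2]; apply: vel_orth_fixed => //; exact: MDR_cap.
by move=> f1 f2; apply: vel_orth_fixed => //; exact: MDR_cap_orth.
Qed.

Lemma theta_vel k : (N <= k)%N ->
  theta z k.+1 = acos (enorm (vel z k.+1) / enorm (vel z k)).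
Proof. by move=> Nk; rewrite /theta /= vel_MDR// angle_MDR. Qed.

Lemma plane_form_vel u v k j : friedrichs_pair T1 T2 u v -> (N <= k)%N ->
  plane_form u v (vel z (j + k)) = (dot u v ^+ 2) ^+ j * plane_form u v (vel z k).
Proof.
move=> uv Nk; elim: j => [|j IH]; first by rewrite mul1r.
rewrite addSn vel_MDR; last by rewrite (leq_trans Nk) ?leq_addl.
by rewrite (plane_form_MDR T1 T2 u v uv) IH (exprS _ j) mulrA.
Qed.

(** If the cosine were [0], one application of the operator would annihilate the plane form. The
    excited index is taken beyond [N], so that its velocity is such an image. *)
Lemma friedrichs_excited_cos_gt0 u v : friedrichs_pair T1 T2 u v ->
  friedrichs_excited T1 T2 z -> 0 < dot u v.
Proof.
move=> uv /(_ N.+1)[[//|k] Nk [s [t [st exc]]]].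
(* The exciting pair may differ from [(u, v)], but maximality gives both the same cosine. *)
have <- : dot s t = dot u v.
  by apply/eqP; rewrite eq_le (st.2 _ _ uv.1) (uv.2 _ _ st.1).
rewrite lt_def (friedrichs_cos_ge0 _ _ _ _ st) andbT; apply/negP => /eqP c0.
have := plane_form_gt0 _ _ _ _ st _ exc.
by rewrite vel_MDR// (plane_form_MDR _ _ _ _ st) c0 expr0n mul0r ltxx.
Qed.

Lemma theta_cvg u v : friedrichs_pair T1 T2 u v -> friedrichs_excited T1 T2 z ->
  theta z @ \oo --> acos (dot u v).
Proof.
move=> uv ex; have cuv := friedrichs_excited_cos_gt0 u v uv ex.
have cuv1 := friedrichs_cos_lt1 _ _ _ _ uv.
have [k Nk [s [t [st exc]]]] := ex N.
have cE : dot s t = dot u v.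
  by apply/eqP; rewrite eq_le (st.2 _ _ uv.1) (uv.2 _ _ st.1).
have q0 := plane_form_gt0 _ _ _ _ st _ exc.
(* Squared norms from the excited index on: [cvg_ratio] is used with [rho] the squared cosine and
   [delta] a quarter of the plane form at that index. *)
pose a j := dot (vel z (j + k)) (vel z (j + k)).
have Njk j : (N <= j + k)%N by rewrite (leq_trans Nk) ?leq_addl.
have lb j : plane_form s t (vel z k) / 4 * (dot s t ^+ 2) ^+ j <= a j.
  have := plane_form_le _ _ _ _ st (vel z (j + k)).
  by rewrite (plane_form_vel _ _ _ _ st Nk) -/(a j) => ?; lra.
have c20 : 0 < dot s t ^+ 2 by rewrite cE exprn_gt0.
have a_gt0 j : 0 < a j.
  by apply: lt_le_trans (lb j); apply: mulr_gt0; [exact: divr_gt0|exact: exprn_gt0].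
have ra : a j.+1 / a j @[j --> \oo] --> dot s t ^+ 2.
  apply: (cvg_ratio K a _ (plane_form s t (vel z k) / 4)) => //.
  - by rewrite divr_gt0.
  - move=> j; have := MDR_log_convex T1 T2 (vel z (j + k)).
    by rewrite -(vel_MDR (j + k)%N)// -(vel_MDR (j + k).+1)// leqW.
  - by move=> j; rewrite /a addSn; exact: vel_contract.
(* The angle at [j + k.+1] compares the velocities at [j.+1 + k] and [j + k], whence a shift by
   [k.+1]. *)
rewrite -(cvg_shiftn k.+1).
have -> : [sequence theta z (j + k.+1)]_j =
    (fun j => acos (Num.sqrt (a j.+1 / a j))).
  apply/funext => j; rewrite /= addnS theta_vel// /enorm; congr acos.
  by rewrite sqrtrM ?dot_ge0// sqrtrV ?dot_ge0.
have -> : dot u v = Num.sqrt (dot s t ^+ 2) by rewrite cE sqrtr_sqr gtr0_norm.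
apply: (@continuous_cvg _ _ _ _ _ _ (@acos K)).
  apply: continuous_acos; rewrite cE sqrtr_sqr gtr0_norm//; apply/andP; split=> //; lra.
apply: (@continuous_cvg _ _ _ _ _ _ (@Num.sqrt K)) => //.
exact: sqrt_continuous.
Qed.

End LinearRegime.

(** * Finite identification of the linear regime and limit of the angles *)

Theorem theorem3p10 (K : realType) (n : nat)
  (R J : 'rV[K]_n -> \bar K)
  (hR : proper_convex_lsc R) (hJ : proper_convex_lsc J)
  (hri : ri (dom R) `&` ri (dom J) !=set0)
  (hargmin : argmin (fun y => R y + J y)%E !=set0)
  (gamma : K) (hgamma : 0 < gamma)
  (u z x : nat -> 'rV[K]_n)
  (hx0 : prox gamma J (z 0%N) (x 0%N))
  (hu : forall k : nat, prox gamma R (2 *: x k - z k) (u k.+1))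
  (hz : forall k : nat, z k.+1 = z k + u k.+1 - x k)
  (hx : forall k : nat, prox gamma J (z k.+1) (x k.+1))
  (zs xs : 'rV[K]_n)
  (hzs : z @ \oo --> zs)
  (hxs : prox gamma J zs xs)
  (MR MJ : set 'rV[K]_n)
  (hpsR : partly_smooth R MR xs) (hpsJ : partly_smooth J MJ xs)
  (TR TJ : {vspace 'rV[K]_n})
  (hTR : [set` TR] = tangent_space MR xs)
  (hTJ : [set` TJ] = tangent_space MJ xs)
  (hndR : exists2 g, ri (subdiff R xs) g & xs - zs = gamma *: g)
  (hndJ : exists2 g, ri (subdiff J xs) g & zs - xs = gamma *: g)
  (hpolyR : locally_polyhedral R xs) (hpolyJ : locally_polyhedral J xs) :
  (\forall k \near \oo, z k.+1 - z k = MDR TR TJ (z k - z k.-1)) /\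
  ((\dim (TR :&: TJ) < minn (\dim TR) (\dim TJ))%N ->
   exists thetaF : K,
     [/\ 0 < thetaF <= pi / 2,
         friedrichs_angle TR TJ thetaF &
         friedrichs_excited TR TJ z ->
         theta z @ \oo --> thetaF /\ type_II z]).
Proof.
have [pR cR _] := hR; have [pJ cJ _] := hJ.
have [_ _ sharpR _] := hpsR; have [_ _ sharpJ _] := hpsJ.
rewrite sharpR in hTR; rewrite sharpJ in hTJ.
have [gR riR gRE] := hndR; have [gJ riJ gJE] := hndJ.
have proxJ : \forall k \near \oo, x k = xs + oproj TJ (z k - zs).
  have proxJ k : prox gamma J (z k) (x k) by case: k.
  suff : \forall k \near \oo, forall y,
      prox gamma J (z k) y -> y = xs + oproj TJ (z k - zs).
    by apply: filterS => k; apply; exact: proxJ.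
  exact: (hzs _ (prox_locally_affine _ _ _ _ _ _ hgamma pJ cJ hpolyJ hTJ riJ gJE)).
have x_cvg : x @ \oo --> xs.
  have : xs + oproj TJ (z k - zs) @[k --> \oo] --> xs + oproj TJ (zs - zs).
    by apply: cvgD; [exact: cvg_cst|apply: cvg_oproj; apply: cvgB => //; exact: cvg_cst].
  rewrite subrr oproj_id ?mem0v// addr0; apply: cvg_trans.
  by apply: near_eq_cvg; apply: filterS proxJ => k ->.
(* For [R] the base point is the reflection [2 *: xs - zs], whose displacement from [xs] is
   [xs - zs]. *)
have wsE : (2 *: xs - zs) - xs = gamma *: gR.
  by rewrite -gRE; apply/rowP => i; rewrite !mxE; ring.
have refl_cvg : 2 *: x k - z k @[k --> \oo] --> 2 *: xs - zs.
  by apply: cvgB => //; exact: cvgZl_tmp.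
have proxR : \forall k \near \oo,
    u k.+1 = xs + oproj TR (2 *: x k - z k - (2 *: xs - zs)).
  suff : \forall k \near \oo, forall y, prox gamma R (2 *: x k - z k) y ->
      y = xs + oproj TR (2 *: x k - z k - (2 *: xs - zs)).
    by apply: filterS => k; apply; exact: hu.
  exact: (refl_cvg _ (prox_locally_affine _ _ _ _ _ _ hgamma pR cR hpolyR hTR riR wsE)).
(* With [e = z k - zs], the step reads [e + P_R (2 P_J e - e) - P_J e], which regroups into the two
   products of [MDR]. *)
have err : \forall k \near \oo, z k.+1 - zs = MDR TR TJ (z k - zs).
  near=> k.
  have xk : x k = xs + oproj TJ (z k - zs) by near: k.
  have uk : u k.+1 = xs + oproj TR (2 *: x k - z k - (2 *: xs - zs)) by near: k.
  rewrite hz uk xk.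
  have -> : 2 *: (xs + oproj TJ (z k - zs)) - z k - (2 *: xs - zs) =
      2 *: oproj TJ (z k - zs) - (z k - zs).
    by apply/rowP => i; rewrite !mxE; ring.
  have zkE : z k = (z k - zs) + zs by rewrite subrK.
  rewrite {1}zkE; move: (z k - zs) => e; rewrite /MDR !oprojB !oprojZ.
  by apply/rowP => i; rewrite !mxE; ring.
have [N _ errN_] := err.
have errN k : (N <= k)%N -> z k.+1 - zs = MDR TR TJ (z k - zs) by exact: errN_.
(* A velocity is the difference of two consecutive errors, both of which must be past [N]: hence the
   threshold [N.+1]. *)
have velN k : (N.+1 <= k)%N -> vel z k.+1 = MDR TR TJ (vel z k).
  move=> Nk; have k0 : (0 < k)%N := leq_ltn_trans (leq0n N) Nk.
  have e1 := errN k (ltnW Nk).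
  have Nk1 : (N <= k.-1)%N by rewrite -ltnS prednK.
  have := errN k.-1 Nk1; rewrite (prednK k0) => e0.
  rewrite /vel /=.
  have -> : z k - z k.-1 = (z k - zs) - (z k.-1 - zs) by rewrite opprB addrA subrK.
  by rewrite MDRB -e1 -e0 opprB addrA subrK.
split; first by exists N.+1 => // k; exact: velN.
move=> hdim.
(* The dimension bound excludes inclusion either way, as [friedrichs_pair_exists] asks. *)
have notsub (T T' : {vspace 'rV[K]_n}) : (\dim (T :&: T') < \dim T)%N -> ~~ (T <= T')%VS.
  by apply: contraTN => /capv_idPl ->; rewrite ltnn.
have [a [b ab]] : exists a b, friedrichs_pair TR TJ a b.
  move: hdim; rewrite leq_min => /andP[dR dJ].
  by apply: friedrichs_pair_exists; apply: notsub; rewrite // capvC.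
have [tI tc tlt] := friedrichs_angle_acos _ _ _ _ ab.
exists (acos (dot a b)); split=> //; first by split=> //; exists a, b.
move=> ex; have cvg := theta_cvg _ _ _ _ _ hzs velN _ _ ab ex.
split=> //; exists (acos (dot a b)) => //.
rewrite tlt ?andbT; first by case/andP: tI.
exact: friedrichs_excited_cos_gt0 velN _ _ ab ex.
Unshelve. all: by end_near. Qed.
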